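(* Let $n\in\mathbb N$ and let $\mathcal A=\bigotimes C^{n+1}$ be the real algebra described in the context. For $p\in\{0,1,\ldots,2^n-1\}$ with binary representation $p=(p_1p_2\ldots p_n)_2$, put $$\widehat e_p=\frac1{2^n}\prod_{k=1}^{n}\left[\widehat 1-(-1)^{p_k}\,\widehat\imath_0\widehat\imath_k\right].$$ Then the elements $\widehat e_0,\ldots,\widehat e_{2^n-1}$ are $2^n$ orthogonal idempotents of $\mathcal A$, i.e. for all $p,q\in\{0,1,\ldots,2^n-1\}$, $$\widehat e_p\widehat e_q=\begin{cases}\widehat e_p,&p=q,\\ \widehat 0,&p\neq q.\end{cases}$$
   Context: $\bigotimes C^{n+1}=C_0\otimes C_1\otimes\cdots\otimes C_n$ is the tensor product over $\mathbb R$ (called ''direct product'' in the paper) of $n+1$ copies $C_k$ of the complex field, regarded as two-dimensional real algebras with bases $\{\widehat 1_k,\widehat\imath_k\}$, where $\widehat\imath_k^2=-\widehat 1_k$. It is a commutative, associative, unital real algebra of dimension $2^{n+1}$, with unit $\widehat 1$. The element $\widehat\imath_k$ is identified with its image in the tensor product, so $\widehat\imath_k^2=-\widehat 1$ for $k=0,\ldots,n$, and the products $\widehat\imath_0^{q_0}\widehat\imath_1^{q_1}\cdots\widehat\imath_n^{q_n}$ with $q_k\in\{0,1\}$ form a real basis. *)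

(* Defs.v *)
From HB Require Import structures.
From mathcomp Require Import all_boot all_order all_algebra.
From mathcomp Require Import reals complex.
Set Implicit Arguments.
Unset Strict Implicit.
Unset Printing Implicit Defensive.
Import GRing.Theory.
Local Open Scope ring_scope.

(* The basis {1, i} of C over R, indexed by the exponent of i, and the
   coordinates of a complex number in that basis. *)
Definition Cbasis (R : realType) (b : bool) : R[i] :=
  if b then 'i%C else 1.

Definition Ccoord (R : realType) (b : bool) (z : R[i]) : R :=
  if b then complex.Im z else complex.Re z.

(* C_0 (x) ... (x) C_n over the reals: x q is the coordinate of x on
   b_0 (x) ... (x) b_n, where b_k = Cbasis R (q k). *)
Definition tensC (R : realType) (n : nat) : Type :=
  {ffun {ffun 'I_n.+1 -> bool} -> R}.

HB.instance Definition _ (R : realType) (n : nat) :=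
  GRing.Lmodule.copy (tensC R n) {ffun {ffun 'I_n.+1 -> bool} -> R^o}.

(* The decomposable tensor z_0 (x) ... (x) z_n. *)
Definition tens_pure (R : realType) (n : nat) (z : 'I_n.+1 -> R[i]) :
    tensC R n :=
  [ffun q : {ffun 'I_n.+1 -> bool} => \prod_k Ccoord (q k) (z k)].

Definition tens_one (R : realType) (n : nat) : tensC R n :=
  tens_pure (fun=> 1).

(* Bilinear extension of (a_0 (x) ... (x) a_n) (b_0 (x) ... (x) b_n) =
   a_0 b_0 (x) ... (x) a_n b_n; this identity is tens_pureM below. *)
Definition tens_mul (R : realType) (n : nat) (x y : tensC R n) : tensC R n :=
  \sum_(r : {ffun 'I_n.+1 -> bool}) \sum_(s : {ffun 'I_n.+1 -> bool})
    (x r * y s) *: tens_pure (fun k => Cbasis R (r k) * Cbasis R (s k)).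

Section TensTheory.
Variables (R : realType) (n : nat).
Local Notation A := (tensC R n).
Local Notation I := {ffun 'I_n.+1 -> bool}.
Implicit Types (x y z : A) (u v w : 'I_n.+1 -> R[i]) (q r s : I).

Lemma eq_tens_pure u v : u =1 v -> tens_pure u = tens_pure v.
Proof.
by move=> uv; apply/ffunP=> q; rewrite !ffunE; apply: eq_bigr=> k _; rewrite uv.
Qed.

Lemma Ccoord_basis (a b : bool) : Ccoord a (Cbasis R b) = (a == b)%:R.
Proof. by case: a; case: b. Qed.

Lemma tensDE x y q : (x + y) q = x q + y q.
Proof. exact: ffunE. Qed.

Lemma tensZE (a : R) x q : (a *: x) q = a * x q.
Proof. exact: ffunE. Qed.

Lemma tens_sumE (J : finType) (F : J -> A) q : (\sum_j F j) q = \sum_j F j q.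
Proof. exact: sum_ffunE. Qed.

Lemma tens_pureD1 (k : 'I_n.+1) u q :
  tens_pure u q = Ccoord (q k) (u k) * \prod_(j | j != k) Ccoord (q j) (u j).
Proof. by rewrite ffunE (bigD1 k). Qed.

(* tens_pure is multilinear and sends product basis vectors to a basis. *)
Lemma tens_pure_multilinear (k : 'I_n.+1) (a : R) u v w :
    (forall j, j != k -> u j = v j) -> (forall j, j != k -> w j = v j) ->
    u k = (a%:C)%C * v k + w k ->
  tens_pure u = a *: tens_pure v + tens_pure w.
Proof.
move=> uv wv uk; apply/ffunP=> q; rewrite tensDE tensZE.
rewrite !(tens_pureD1 k) uk.
have -> : \prod_(i < n.+1 | i != k) Ccoord (q i) (u i)
    = \prod_(i < n.+1 | i != k) Ccoord (q i) (v i).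
  by apply: eq_bigr=> j jk; rewrite uv.
have -> : \prod_(i < n.+1 | i != k) Ccoord (q i) (w i)
    = \prod_(i < n.+1 | i != k) Ccoord (q i) (v i).
  by apply: eq_bigr=> j jk; rewrite wv.
rewrite mulrA -mulrDl; congr (_ * _).
case: (v k) (w k) => [b c] [d e]; rewrite /Ccoord.
by case: (q k) => /=; rewrite mul0r ?addr0 ?subr0.
Qed.

Lemma tens_pure_basis r q : tens_pure (fun k => Cbasis R (r k)) q = (q == r)%:R.
Proof.
rewrite ffunE; case: (altP (q =P r)) => [->|qr].
  by rewrite big1 // => k _; rewrite Ccoord_basis eqxx.
have /existsP[k qrk] : [exists k, q k != r k].
  apply: contraNT qr; rewrite negb_exists => /forallP h.
  by apply/eqP/ffunP=> k; apply/eqP; move: (h k); rewrite negbK.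
by rewrite (bigD1 k) //= Ccoord_basis (negbTE qrk) mul0r.
Qed.

Lemma tens_decomp x : x = \sum_r x r *: tens_pure (fun k => Cbasis R (r k)).
Proof.
apply/ffunP=> q; rewrite tens_sumE (bigD1 q) //= big1.
  by rewrite addr0 tensZE tens_pure_basis eqxx mulr1.
by move=> r rq; rewrite tensZE tens_pure_basis eq_sym (negbTE rq) mulr0.
Qed.

Fact tens_pureM u v :
  tens_mul (tens_pure u) (tens_pure v) = tens_pure (fun k => u k * v k).
Proof.
apply/ffunP=> t; rewrite tens_sumE [RHS]ffunE.
under [LHS]eq_bigr => r _.
  rewrite tens_sumE.
  under eq_bigr => s _ do rewrite tensZE !ffunE -!big_split /=.
  rewrite -(bigA_distr_bigA (fun k b => Ccoord (r k) (u k) * Ccoord b (v k) *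
     Ccoord (t k) (Cbasis R (r k) * Cbasis R b))).
  over.
rewrite -(bigA_distr_bigA (fun k a => \sum_b Ccoord a (u k) * Ccoord b (v k) *
     Ccoord (t k) (Cbasis R a * Cbasis R b))).
apply: eq_bigr=> k _; rewrite !big_bool /=.
case: (u k) (v k) => [b c] [d e]; rewrite /Ccoord /Cbasis.
case: (t k) => /=;
  rewrite !(mulr0, mulr1, mul0r, mul1r, subr0, addr0, add0r, sub0r).
  by rewrite addrC.
by rewrite mulrN1 oppr0 mulr0 addr0 addrC.
Qed.

Fact tens_mulC : commutative (@tens_mul R n).
Proof.
move=> x y; rewrite /tens_mul exchange_big; apply: eq_bigr=> r _.
apply: eq_bigr=> s _; rewrite mulrC; congr (_ *: _).
by apply: eq_tens_pure=> k; rewrite mulrC.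
Qed.

Fact tens_mulDl : left_distributive (@tens_mul R n) +%R.
Proof.
move=> x y z; rewrite /tens_mul -big_split; apply: eq_bigr=> r _ /=.
by rewrite -big_split; apply: eq_bigr=> s _ /=; rewrite ffunE mulrDl scalerDl.
Qed.

Fact tens_scaleAl (a : R) x y : a *: tens_mul x y = tens_mul (a *: x) y.
Proof.
rewrite /tens_mul scaler_sumr; apply: eq_bigr=> r _.
rewrite scaler_sumr; apply: eq_bigr=> s _.
by rewrite scalerA mulrA tensZE.
Qed.

Let tens_mul_suml (J : finType) (F : J -> A) y :
  tens_mul (\sum_j F j) y = \sum_j tens_mul (F j) y.
Proof.
apply: (big_morph (fun x => tens_mul x y)) => [x z|]; first exact: tens_mulDl.
by have := tens_scaleAl 0 0 y; rewrite !scale0r => <-.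
Qed.

Fact tens_mul1 : left_id (tens_one R n) (@tens_mul R n).
Proof.
move=> x; rewrite tens_mulC [in LHS](tens_decomp x) tens_mul_suml.
rewrite [RHS]tens_decomp; apply: eq_bigr=> r _.
rewrite -tens_scaleAl tens_pureM; congr (_ *: _).
by apply: eq_tens_pure=> k; rewrite mulr1.
Qed.

Let tens_mul_lin (a : R) x y z :
  tens_mul (a *: x + y) z = a *: tens_mul x z + tens_mul y z.
Proof. by rewrite tens_mulDl tens_scaleAl. Qed.

Let tens_mul_linr (a : R) x y z :
  tens_mul z (a *: x + y) = a *: tens_mul z x + tens_mul z y.
Proof. by rewrite !(tens_mulC z) tens_mul_lin. Qed.

Let tens_mul0 z : tens_mul 0 z = 0.
Proof. by have := tens_scaleAl 0 0 z; rewrite !scale0r => <-. Qed.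

Let tens_mulr0 z : tens_mul z 0 = 0.
Proof. by rewrite tens_mulC tens_mul0. Qed.

Lemma tens_ind (P : A -> Prop) :
  P 0 -> (forall (a : R) x y, P x -> P y -> P (a *: x + y)) ->
  (forall u, P (tens_pure u)) -> forall x, P x.
Proof.
move=> P0 PD Pu x; rewrite (tens_decomp x).
apply: (big_ind P) => // [y z Py Pz|r _].
  by rewrite -(scale1r y); apply: PD.
by rewrite -[X in P X]addr0; apply: PD.
Qed.

Fact tens_mulA : associative (@tens_mul R n).
Proof.
move=> x y z; move: x.
apply: tens_ind => [|a x1 x2 h1 h2|u]; first by rewrite !tens_mul0.
  by rewrite !tens_mul_lin h1 h2.
move: y; apply: tens_ind => [|a y1 y2 h1 h2|v].
- by rewrite tens_mulr0 !tens_mul0 tens_mulr0.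
- by rewrite tens_mul_linr !tens_mul_lin tens_mul_linr h1 h2.
move: z; apply: tens_ind => [|a z1 z2 h1 h2|w]; first by rewrite !tens_mulr0.
  by rewrite !tens_mul_linr h1 h2.
by rewrite !tens_pureM; apply: eq_tens_pure=> k; rewrite mulrA.
Qed.

Fact tens_one_neq0 : tens_one R n != 0.
Proof.
apply/eqP=> /ffunP/(_ [ffun=> false]); rewrite !ffunE big1 => [/eqP|k _].
  by rewrite oner_eq0.
by rewrite ffunE.
Qed.

End TensTheory.

HB.instance Definition _ (R : realType) (n : nat) :=
  GRing.Zmodule_isComNzRing.Build (tensC R n)
    (@tens_mulA R n) (@tens_mulC R n) (@tens_mul1 R n) (@tens_mulDl R n)
    (@tens_one_neq0 R n).
HB.instance Definition _ (R : realType) (n : nat) :=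
  GRing.Lmodule_isLalgebra.Build R (tensC R n) (@tens_scaleAl R n).
HB.instance Definition _ (R : realType) (n : nat) :=
  GRing.Lalgebra_isComAlgebra.Build R (tensC R n).

(* The image 1 (x) ... (x) i (x) ... (x) 1 of the imaginary unit of C_k. *)
Definition ihat (R : realType) (n : nat) (k : 'I_n.+1) : tensC R n :=
  tens_pure (fun j => if j == k then 'i%C else 1).

Lemma ihat_sqr (R : realType) (n : nat) (k : 'I_n.+1) : ihat R k ^+ 2 = -1.
Proof.
rewrite expr2 [LHS]tens_pureM -[RHS]scaleN1r.
apply/ffunP=> q; rewrite tensZE !(tens_pureD1 k) eqxx mulrA.
congr (_ * _); last by apply: eq_bigr=> j /negbTE->; rewrite mulr1.
by case: (q k); rewrite /Ccoord /= !(mulr0, mul0r, mulr1, sub0r, add0r, addr0).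
Qed.

Lemma tens_pure_prod (R : realType) (n : nat) (J : finType)
    (z : J -> 'I_n.+1 -> R[i]) :
  \prod_j tens_pure (z j) = tens_pure (fun k => \prod_j z j k).
Proof.
elim: (index_enum J) => [|j l IHl].
  by rewrite big_nil; apply: (@eq_tens_pure R n) => k; rewrite big_nil.
rewrite big_cons IHl [LHS]tens_pureM.
by apply: eq_tens_pure => k; rewrite big_cons.
Qed.

(* The coordinates defining tensC are those on the products of the ihat k. *)
Lemma ihat_basis (R : realType) (n : nat) (x : tensC R n) :
  x = \sum_(q : {ffun 'I_n.+1 -> bool}) x q *: \prod_k ihat R k ^+ q k.
Proof.
rewrite [LHS]tens_decomp; apply: eq_bigr => q _; congr (_ *: _).
rewrite (eq_bigr (fun k => tens_pure
  (fun j => if j == k then Cbasis R (q k) else 1))).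
  rewrite tens_pure_prod; apply: eq_tens_pure => k.
  by rewrite (bigD1 k) //= eqxx big1 ?mulr1 // => j /negbTE; rewrite eq_sym => ->.
move=> k _; case: (q k); first by rewrite expr1.
by rewrite expr0; apply: eq_tens_pure => j; case: ifP.
Qed.

(* The digit p_k of p = (p_1 p_2 ... p_n)_2, p_1 being the most significant. *)
Definition bindigit (n p k : nat) : bool := odd (p %/ 2 ^ (n - k)).

Lemma bindigit_sum (n p : nat) : (p < 2 ^ n)%N ->
  p = (\sum_(1 <= k < n.+1) bindigit n p k * 2 ^ (n - k))%N.
Proof.
elim: n p => [|n IHn] p; first by rewrite big_nil; case: p.
move=> pn; rewrite big_nat_recr //= subnn muln1 /bindigit subnn divn1.
have hp : (p./2 < 2 ^ n)%N.
  by rewrite -divn2 ltn_divLR // mulnC -expnS.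
rewrite -[LHS]odd_double_half addnC {1}(IHn _ hp) -mul2n big_distrr /=.
congr (_ + _)%N; apply: eq_big_nat => k /andP[_ kn].
by rewrite /bindigit subSn // expnS -divn2 -divnMA mulnCA.
Qed.

(* Here k < n and lift ord0 k has value k + 1, so the factors run over
   the indices 1, ..., n. *)
Definition ehat (R : realType) (n p : nat) : tensC R n :=
  (2 ^+ n)^-1 *: \prod_(k < n)
    (1 - (-1) ^+ bindigit n p k.+1 *: (ihat R ord0 * ihat R (lift ord0 k))).

(* Main.v *)
Require Import Defs.
From mathcomp Require Import all_boot all_order all_algebra.
From mathcomp Require Import reals.
From mathcomp Require Import ring.
Import GRing.Theory Num.Theory.
Local Open Scope ring_scope.

(** The elements [j_k = ihat 0 * ihat k] satisfy [j_k ^+ 2 = 1], so each of them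
    splits the unit into the two complementary idempotents [(1 - j_k) / 2] and
    [(1 + j_k) / 2], whose product is zero ([half_sign_mul]).  Sharing [2 ^ n]
    among the factors, [ehat R n p] is a product over [k] of one idempotent from
    each pair, the binary digit [p_k] deciding which ([ehatE]).  As the algebra
    is commutative, [ehat R n p * ehat R n q] can be computed factor by factor:
    for [p = q] every factor is reproduced, and for [p <> q] the two numbers
    differ in some digit ([bindigit_neq]), where the factor vanishes. *)

Section HalfSign.
Variables (F : numFieldType) (A : comAlgType F).

Definition half_sign (j : A) (e : bool) : A := 2^-1 *: (1 - (-1) ^+ e *: j).

(** With signs [s] and [t], [j ^+ 2 = 1] gives
    [(1 - s *: j) * (1 - t *: j) = (1 + s * t)%:A - (s + t) *: j], which is
    twice the first factor if [s = t], and zero if [s = - t]. *)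
Lemma half_sign_mul (j : A) (e f : bool) : j ^+ 2 = 1 ->
  half_sign j e * half_sign j f = if e == f then half_sign j e else 0.
Proof.
move=> j2; rewrite /half_sign -scalerAl -scalerAr.
suff -> : (1 - (-1) ^+ e *: j) * (1 - (-1) ^+ f *: j)
    = if e == f then 2 *: (1 - (-1) ^+ e *: j) else 0.
  case: eqP => _; last by rewrite !scaler0.
  by rewrite (scalerA 2^-1 2) mulVf ?scale1r // pnatr_eq0.
rewrite mulrBl mul1r mulrBr mulr1 -scalerAl -scalerAr -expr2 j2 scalerA.
rewrite scaler_nat mulr2n.
case: e f => [] [] /=; rewrite !(expr1, expr0, mulN1r, mulrN1, mulr1, opprK).
all: by rewrite !(scaleN1r, scale1r); ring.
Qed.
End HalfSign.

Lemma ihat_mul_sqr (R : realType) (n : nat) (k l : 'I_n.+1) :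
  (ihat R k * ihat R l) ^+ 2 = 1.
Proof. by rewrite exprMn !ihat_sqr mulrNN mulr1. Qed.

Lemma ehatE (R : realType) (n p : nat) :
  ehat R n p = \prod_(k < n)
    half_sign R _ (ihat R ord0 * ihat R (lift ord0 k)) (bindigit n p k.+1).
Proof. by rewrite scaler_prod prodr_const card_ord exprVn. Qed.

Lemma bindigit_neq (n p q : nat) : (p < 2 ^ n)%N -> (q < 2 ^ n)%N -> p != q ->
  exists k : 'I_n, bindigit n p k.+1 != bindigit n q k.+1.
Proof.
move=> hp hq pq; apply/existsP; apply: contraNT pq.
rewrite negb_exists => /forallP eq_digits; apply/eqP.
rewrite (bindigit_sum hp) (bindigit_sum hq).
apply: eq_big_nat => -[//|k] /andP[_ kn].
by have := eq_digits (Ordinal (kn : (k < n)%N)); rewrite negbK => /eqP ->.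
Qed.

Theorem mainTheorem1 (R : realType) (n : nat) (p q : nat)
    (hp : (p < 2 ^ n)%N) (hq : (q < 2 ^ n)%N) :
  ehat R n p * ehat R n q = if p == q then ehat R n p else 0.
Proof.
rewrite !ehatE -big_split /=; case: (altP (p =P q)) => [->|pq].
  by apply: eq_bigr => k _; rewrite half_sign_mul ?ihat_mul_sqr // eqxx.
have [k kpq] := bindigit_neq n p q hp hq pq.
rewrite (bigD1 k) //= half_sign_mul ?ihat_mul_sqr //.
by rewrite (negbTE kpq) mul0r.
Qed.
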